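(* Consider weighted fair share policies in the arrival-only model. (Upper bound) There exist absolute constants $c \ge 1$ and $C > 0$ such that for every $n \ge 1$ there is an online allocation policy $A$ which, on every arrival-only instance with $n$ arriving jobs in total (with arbitrary positive weights), is feasible and $c$-approximate with respect to the weighted fair share policy, and disrupts each job at most $C \log^* n$ times. (Lower bound) For every constant $c \ge 1$ there exist a constant $\kappa > 0$ and an integer $n_0$, depending only on $c$, such that for every $n \ge n_0$ and every deterministic online feasible $c$-approximate allocation policy $A$ (for the weighted fair share policy) there is an arrival-only instance with $n$ jobs on which $A$ makes at least $\kappa \log^* n$ disruptions per job on average, i.e. at least $\kappa\, n \log^* n$ disruptions in total.
   Context: Model. There is one unit of a single divisible resource. An instance is a sequence of sets of alive jobs $N^0, N^1, N^2,\dots$; jobs in $N^t\setminus N^{t-1}$ arrive at time $t$ and jobs in $N^{t-1}\setminus N^t$ depart at time $t$. Each job $j$ has a weight $w_j>0$, revealed on its arrival. The arrival-only model means $N^{t-1}\subseteq N^t$ for all $t$. The weighted fair share policy gives job $j \in N^t$ the ideal fair share $I(j,t) = w_j / \sum_{k\in N^t} w_k$. An allocation policy $A$ determines, at each time $t$, an allocation $A(j,t)\ge 0$ for every $j\in N^t$; it is online, i.e. the allocations at time $t$ depend only on what has been revealed up to time $t$ (the total number $n$ of jobs is assumed known a priori). It is feasible if $\sum_{j\in N^t}A(j,t)\le 1$ for all $t$. For $c\ge 1$, $A$ is $c$-approximate if $A(j,t)\ge I(j,t)/c$ for all $t$ and all $j\in N^t$. A disruption of job $j$ at time $t$ is a change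 in its allocation: $j\in N^{t-1}\cap N^t$ and $A(j,t)\ne A(j,t-1)$. The number of disruptions is counted over all jobs and times. $\log^* n$ is the iterated (base-2) logarithm. *)

(* Defs.v *)
From HB Require Import structures.
From mathcomp Require Import all_boot all_order all_algebra.
From mathcomp Require Import reals exp.

Set Implicit Arguments.
Unset Strict Implicit.
Unset Printing Implicit Defensive.

Import Order.TTheory GRing.Theory Num.Theory.

Local Open Scope ring_scope.

Section IteratedLogarithm.
Context {R : realType}.

Definition log2 (x : R) : R := ln x / ln 2.

Lemma iter_log2_le1 k (x : R) : x <= k.+1%:R -> iter k log2 x <= 1.
Proof.
elim: k x => [|k IHk] x hx //=; rewrite -iterS iterSr; apply: IHk.
have ln2_gt0 : 0 < ln 2 :> R by rewrite ln_gt0 // ltr1n.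
rewrite /log2 ler_pdivrMr // mulr_natl -lnXn //.
have [x_le0|x_gt0] := leP x 0.
  apply: le_trans (ln_ge0 _); last by rewrite exprn_ege1 // ler1n.
  exact/ln_le0/(le_trans x_le0).
rewrite ler_ln ?posrE ?exprn_gt0 //; apply: (le_trans hx).
by rewrite -natrX ler_nat ltn_expl.
Qed.

Lemma ex_iter_log2_le1 (n : nat) : exists k, iter k log2 n%:R <= 1.
Proof. by exists n; apply: iter_log2_le1; rewrite ler_nat. Qed.

Definition logstar (n : nat) : nat := ex_minn (ex_iter_log2_le1 n).

End IteratedLogarithm.

Arguments logstar R n : clear implicits.

Section FairAllocation.
Context {R : realType} {n : nat}.

(* The [n] jobs are named by ['I_n]; the name itself carries no information on
   the arrival time or on the weight of the job. *)
Record instance := Instance {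
  alive : nat -> {set 'I_n};
  weight : 'I_n -> R;
  weight_gt0 : forall j, 0 < weight j }.

Implicit Types (I : instance) (t : nat) (j : 'I_n).

Definition arrival_only I : Prop := forall t, alive I t \subset alive I t.+1.

Definition all_arrive I : Prop := forall j, exists t, j \in alive I t.

(* The arrival-only instances with exactly [n] jobs in total. *)
Definition arrival_instance I : Prop := arrival_only I /\ all_arrive I.

Definition ideal_share I j t : R :=
  weight I j / \sum_(k in alive I t) weight I k.

(* [A I j t] is relevant only for [j \in alive I t]; the definitions below
   ignore its other values. *)
Definition policy := instance -> 'I_n -> nat -> R.

Implicit Type A : policy.

Definition nonneg A : Prop :=
  forall I, arrival_instance I ->
  forall t j, j \in alive I t -> 0 <= A I j t.

(* The information revealed up to time [t]: the alive sets, and the weights of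
   the jobs that have arrived. *)
Definition same_history I1 I2 t : Prop :=
  forall s, (s <= t)%N ->
    alive I1 s = alive I2 s /\ {in alive I1 s, weight I1 =1 weight I2}.

Definition online A : Prop :=
  forall I1 I2, arrival_instance I1 -> arrival_instance I2 ->
  forall t, same_history I1 I2 t ->
    {in alive I1 t, forall j, A I1 j t = A I2 j t}.

Definition online_policy A : Prop := nonneg A /\ online A.

Definition feasible A : Prop :=
  forall I, arrival_instance I ->
  forall t, \sum_(j in alive I t) A I j t <= 1.

Definition approximate (c : R) A : Prop :=
  forall I, arrival_instance I ->
  forall t j, j \in alive I t -> ideal_share I j t / c <= A I j t.

(* For [t = 0] this is false, since [0.-1 = 0]. *)
Definition disrupted A I j t : bool :=
  (j \in alive I t.-1 :&: alive I t) && (A I j t != A I j t.-1).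

(* Counting up to a horizon [T] avoids infinite counts: a job has at most [m]
   disruptions iff this is at most [m] for every [T], and the total is at least
   [m] iff the total up to some horizon is. *)
Definition disruptions A I j (T : nat) : nat :=
  (\sum_(t < T.+1) disrupted A I j t)%N.

Definition total_disruptions A I (T : nat) : nat :=
  (\sum_(j < n) disruptions A I j T)%N.

End FairAllocation.

Arguments instance R n : clear implicits.
Arguments policy R n : clear implicits.

(* Main.v *)
(**
  Upper bound. Cut time into epochs, each starting when the total weight has at
  least doubled since the start of the previous one, and let the age [d] of a job
  be the number of epochs started since its arrival. The jobs of age [d] arrived
  while the total weight was within a factor 2 of a value [b], and the total weight
  is now at least [2^d b]. So job [j] may be given [w_j / (8 b) * g d] for any
  [g] with [g d >= 2^-d] and [\sum_d g d <= 4]. Taking [g] constant, equal to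
  [2^-u], on the blocks of ages [u <= d < v] with [v] about [2^(u/2)], the sum
  converges and [g] changes at most [log^* n] times on [0, n), which bounds the
  number of disruptions of each job.

  Lower bound. Let job [j] have weight [2^j] and arrive at time [j]. At age [d] it
  holds at least [2^-(d+q)], where [q] depends only on [c]. If it is not
  disrupted while its age is in [[D, D + 4 * 2^(D+q))], it keeps at least
  [2^-(D+q)] during that whole period and so consumes 4 units in total. There are
  about [log^* n] such disjoint periods below [n/2], and only [n] units are
  available up to time [n], so most (job, period) pairs have a disruption.
*)
Require Import Defs.
From HB Require Import structures.
From mathcomp Require Import all_boot all_order all_algebra.
From mathcomp Require Import reals exp.
From mathcomp Require Import zify ring lra.

Set Implicit Arguments.
Unset Strict Implicit.
Unset Printing Implicit Defensive.

Import Order.TTheory GRing.Theory Num.Theory.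

Local Open Scope ring_scope.

(** * The tower function as inverse of the iterated logarithm *)

Definition tower (k : nat) : nat := iter k (expn 2) 1%N.

Lemma ltn_tower k : (k < tower k)%N.
Proof. by elim: k => // k IHk; apply: leq_ltn_trans IHk _; rewrite ltn_expl. Qed.

Section TowerLogstar.
Context {R : realType}.

Let ln2_gt0 : 0 < ln 2 :> R.
Proof. by rewrite ln_gt0 // ltr1n. Qed.

Lemma log2_le_nat (x : R) (m : nat) : 0 < x ->
  (log2 x <= m%:R) = (x <= (2 ^ m)%:R).
Proof.
move=> x0; rewrite /log2 ler_pdivrMr // mulr_natl -lnXn //.
by rewrite ler_ln ?posrE ?exprn_gt0 // natrX.
Qed.

Lemma log2_le0 (x : R) : x <= 1 -> log2 x <= 0.
Proof. by move=> x1; rewrite /log2 ler_pdivrMr // mul0r ln_le0. Qed.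

Lemma iter_log2_le1_tower k (x : R) : (iter k log2 x <= 1) = (x <= (tower k)%:R).
Proof.
elim: k x => // k IHk x; rewrite iterSr IHk.
have [x0|x0] := ltP 0 x; first by rewrite log2_le_nat.
(* For [x <= 0] both sides hold: [ln] takes its default value there, so [log2 x <= 0]. *)
rewrite (le_trans (log2_le0 (le_trans x0 ler01))) ?ler0n //.
by rewrite (le_trans x0) ?ler0n.
Qed.

(** [tower] is monotone, so the minimality defining [logstar] becomes an equivalence; all later
    reasoning on [logstar] goes through it. *)
Lemma logstar_leq n k : (logstar R n <= k)%N = (n <= tower k)%N.
Proof.
have towerS m : (tower m <= tower m.+1)%N by rewrite ltnW //= ltn_expl.
rewrite /logstar; case: ex_minnP => m; rewrite iter_log2_le1_tower ler_nat => nm minm.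
apply/idP/idP => [mk|nk].
  by apply: leq_trans nm _; apply: (homo_leq leqnn leq_trans towerS).
by apply: minm; rewrite iter_log2_le1_tower ler_nat.
Qed.

End TowerLogstar.

(** * The slowly changing decay function of the upper bound *)

Section Levels.

(** The ages 0, 2, 4, 8, 32, ... at which the blocks of constant decay begin. *)
Definition threshold (i : nat) : nat := if i is i'.+1 then (2 * tower i')%N else 0.

Fixpoint level (d : nat) : nat :=
  if d is d'.+1 then
    if (threshold (level d').+1 <= d)%N then (level d').+1 else level d'
  else 0.

Lemma threshold_ltS i : (threshold i < threshold i.+1)%N.
Proof. by case: i => // i; rewrite /threshold ltn_pmul2l //= ltn_expl. Qed.

Lemma levelS d : level d.+1 =
  if (threshold (level d).+1 <= d.+1)%N then (level d).+1 else level d.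
Proof. by []. Qed.

Lemma level_bounds d : (threshold (level d) <= d < threshold (level d).+1)%N.
Proof.
elim: d => // d /andP[lo hi]; rewrite levelS.
case: ifPn => [h|]; last by rewrite -ltnNge => ->; rewrite (leq_trans lo).
by rewrite h (leq_ltn_trans hi (threshold_ltS _)).
Qed.

(** The factor 2 in [threshold] pays for this: one copy of [tower] in the exponent gives the length
    of the next block, the other absorbs [2 ^ i]. Hence block [i] has total decay at most
    [2 * 2 ^- i]. *)
Lemma thresholdS_mul i : (threshold i.+1 * 2 ^ i <= 2 * 2 ^ threshold i)%N.
Proof.
case: i => // i; rewrite /= -mulnA leq_pmul2l // -expnD leq_exp2l //.
by have := ltn_tower i; lia.
Qed.

Lemma level_le_logstar (R : realType) n d : (d < n)%N -> (level d <= logstar R n)%N.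
Proof.
move=> dn; case E: (level d) => [//|l]; rewrite ltnNge logstar_leq -ltnNge.
by have := level_bounds d; have := ltn_tower l; rewrite E /=; lia.
Qed.

Definition decay {R : realType} (d : nat) : R := 2 ^- threshold (level d).

Lemma decay_ge {R : realType} d : 2 ^- d <= decay d :> R.
Proof.
rewrite lef_pV2 ?posrE ?exprn_gt0 // ler_weXn2l ?ler1n //.
by have /andP[] := level_bounds d.
Qed.

Lemma sum_decay_le4 {R : realType} D : \sum_(d < D) decay d <= 4 :> R.
Proof.
have key i m : (m <= threshold i.+1)%N -> m%:R * 2 ^- threshold i <= 2 * 2 ^- i :> R.
  move=> mi; rewrite ler_pdivrMr ?exprn_gt0 // mulrAC ler_pdivlMr ?exprn_gt0 //.
  rewrite -!natrX -!natrM ler_nat (leq_trans _ (thresholdS_mul i)) //.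
  by rewrite leq_mul2r mi orbT.
have pos i : 0 < 2 ^- i :> R by rewrite invr_gt0 exprn_gt0.
(* Invariant: the finished blocks use at most [4 - 4 * 2 ^- level D], and the current block is
   charged as if all [D] ages had its value. *)
suff bound : \sum_(d < D) decay d
    <= 4 - 4 * 2 ^- level D + D%:R * 2 ^- threshold (level D) :> R.
  apply: (le_trans bound); have /andP[_ /ltnW/key] := level_bounds D.
  by have := pos (level D); lra.
elim: D => [|D IHD]; first by rewrite big_ord0 /= expr0 invr1; lra.
rewrite big_ord_recr levelS /decay [nat_of_ord ord_max]/=.
apply: le_trans (lerD IHD (lexx _)) _.
have pos' : 0 <= D.+1%:R * 2 ^- threshold (level D).+1 :> R.
  by rewrite mulr_ge0 ?ler0n // ltW.
case: ifPn => h; last by rewrite -[D.+1%:R]natr1 mulrDl mul1r; lra.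
(* When a block ends, its charge is at most half of the slack [4 * 2 ^- level D]; the other half is
   the slack of the next level. *)
have /key : (D.+1 <= threshold (level D).+1)%N by have /andP[] := level_bounds D.
have -> : 2 ^- (level D).+1 = 2 ^- level D / 2 :> R by rewrite exprSr invfM mulrC.
by move: pos'; rewrite -[D.+1%:R]natr1 !mulrDl !mul1r; lra.
Qed.

End Levels.

(** * The epoch policy and its analysis *)

Section UpperBound.
Context {R : realType} {n : nat}.
Implicit Types (I : instance R n) (t : nat) (j : 'I_n).

Definition total_weight I t : R := \sum_(k in alive I t) weight I k.

Fixpoint epoch_base I t : R :=
  if t is t'.+1 then
    if 2 * epoch_base I t' <= total_weight I t then total_weight I t
    else epoch_base I t'
  else total_weight I 0.

Definition new_epoch I t : bool := 2 * epoch_base I t <= total_weight I t.+1.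

(** Frozen once [j] is alive: the base of the epoch in which [j] arrived. Before that it follows the
    current base. *)
Fixpoint entry_base I j t : R :=
  if t is t'.+1 then
    if j \in alive I t' then entry_base I j t' else epoch_base I t
  else epoch_base I 0.

Fixpoint age I j t : nat :=
  if t is t'.+1 then
    if j \in alive I t' then (age I j t' + new_epoch I t')%N else 0%N
  else 0%N.

(** The 8 is the product of the bound 2 on each age class ([sum_same_age]) and the bound 4 on the
    sum of [decay]. *)
Definition epoch_policy : policy R n :=
  fun I j t => weight I j / (8 * entry_base I j t) * decay (age I j t).

Lemma total_weight_ge0 I t : 0 <= total_weight I t.
Proof. by apply: sumr_ge0 => k _; apply/ltW/weight_gt0. Qed.

Lemma total_weight_gt0 I j t : j \in alive I t -> 0 < total_weight I t.
Proof.
move=> jt; rewrite /total_weight (bigD1 j) //=.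
by rewrite ltr_pwDl ?weight_gt0 ?sumr_ge0 // => k _; apply/ltW/weight_gt0.
Qed.

Section Instance.
Variable I : instance R n.
Hypothesis arrI : arrival_only I.

Lemma aliveS j t : j \in alive I t -> j \in alive I t.+1.
Proof. exact/subsetP. Qed.

Lemma total_weight_leS t : total_weight I t <= total_weight I t.+1.
Proof.
rewrite /total_weight [X in _ <= X](bigID (mem (alive I t))) /=.
rewrite [X in X + _](eq_bigl (mem (alive I t))); last first.
  by move=> k /=; apply/andP/idP => [[]//|kt]; split => //; apply: aliveS.
by rewrite lerDl sumr_ge0 // => k _; apply/ltW/weight_gt0.
Qed.

Lemma epoch_base_le t : epoch_base I t <= total_weight I t.
Proof.
elim: t => //= t IHt; case: ifP => // _.
exact: le_trans IHt (total_weight_leS t).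
Qed.

Lemma total_weight_lt j t : j \in alive I t ->
  total_weight I t < 2 * epoch_base I t.
Proof.
have dbl s : j \in alive I s -> total_weight I s < 2 * total_weight I s.
  by move=> /total_weight_gt0; lra.
by case: t => [|t] jt /=; [exact: dbl|case: ifPn => [_|]; [exact: dbl|rewrite -ltNge]].
Qed.

Lemma epoch_base_gt0 j t : j \in alive I t -> 0 < epoch_base I t.
Proof. by move=> jt; have := total_weight_lt jt; have := total_weight_gt0 jt; lra. Qed.

Lemma epoch_baseS_ge t : epoch_base I t * 2 ^+ new_epoch I t <= epoch_base I t.+1.
Proof. by rewrite /= /new_epoch; case: ifP => h; [rewrite expr1 mulrC|rewrite mulr1]. Qed.

Lemma new_epoch_alive j t : j \in alive I t -> new_epoch I t ->
  (#|alive I t| < #|alive I t.+1|)%N.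
Proof.
move=> jt new; apply: proper_card; rewrite properEneq arrI andbT.
apply: contraTneq new => eqA; rewrite /new_epoch -ltNge.
by rewrite /total_weight -eqA (total_weight_lt jt).
Qed.

(** Every new epoch needs an arrival. This keeps ages below [n], hence levels below or at [logstar],
    however long the instance runs. *)
Lemma age_lt_card j t : j \in alive I t -> (age I j t < #|alive I t|)%N.
Proof.
elim: t => [|t IHt] jt /=; first by apply/card_gt0P; exists j.
case: ifP => jt'; last by apply/card_gt0P; exists j.
case new: new_epoch; last by rewrite addn0 (leq_trans (IHt jt')) ?subset_leq_card.
by rewrite addn1 (leq_ltn_trans (IHt jt')) ?(new_epoch_alive jt').
Qed.

Lemma entry_base_gt0 j t : j \in alive I t -> 0 < entry_base I j t.
Proof.
elim: t => [|t IHt] jt; first exact: epoch_base_gt0 jt.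
by rewrite [entry_base _ _ _]/=; case: ifP => [|_]; [|exact: epoch_base_gt0 jt].
Qed.

Lemma entry_base_age j t : j \in alive I t ->
  entry_base I j t * 2 ^+ age I j t <= epoch_base I t.
Proof.
elim: t => [|t IHt] jt; first by rewrite mulr1.
rewrite [entry_base _ _ _]/= [age _ _ _]/=; case: ifP => [jt'|_]; last by rewrite mulr1.
rewrite exprD mulrA; apply: le_trans (epoch_baseS_ge t).
by rewrite ler_wpM2r ?exprn_ge0 // IHt.
Qed.

Lemma entry_base_age0 j t : age I j t = 0%N -> entry_base I j t = epoch_base I t.
Proof.
elim: t => //= t IHt; case: ifP => // jt /eqP; rewrite addn_eq0 => /andP[/eqP a0].
by rewrite /new_epoch; case: ifP => // _ _; apply: IHt.
Qed.

Lemma sum_age0 t :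
  \sum_(j in alive I t | age I j t == 0%N) weight I j / entry_base I j t <= 2.
Proof.
have [->|[i it]] := set_0Vmem (alive I t).
  by rewrite big_pred0 ?ler0n // => j; rewrite inE.
rewrite (eq_bigr (fun j => weight I j / epoch_base I t)); last first.
  by move=> j /andP[_ /eqP/entry_base_age0 ->].
rewrite -mulr_suml ler_pdivrMr ?(epoch_base_gt0 it) //.
apply: le_trans (ltW (total_weight_lt it)).
rewrite /total_weight [X in _ <= X](bigID (fun j => age I j t == 0%N)) /=.
by rewrite lerDl sumr_ge0 // => k _; apply/ltW/weight_gt0.
Qed.

(** Jobs of positive age were already alive one step earlier, with a common age and the same entry
    bases, so the bound goes back to age 0. There all entry bases equal the current base, which
    exceeds half of the total weight. *)
Lemma sum_same_age t d :
  \sum_(j in alive I t | age I j t == d) weight I j / entry_base I j t <= 2.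
Proof.
elim: t d => [|t IHt] d; have [->|] := posnP d.
- exact: sum_age0.
- by case: d => // d _; rewrite big_pred0 // => j; rewrite andbF.
- exact: sum_age0.
case: d => // d _; apply: le_trans (IHt (d.+1 - new_epoch I t)%N).
rewrite big_mkcond [X in _ <= X]big_mkcond; apply: ler_sum => j _ /=.
have [jt|njt] := boolP (j \in alive I t); last by rewrite eq_sym andbF.
by rewrite aliveS //=; case: new_epoch; rewrite ?addn1 ?addn0 ?subn1 ?subn0 ?eqSS.
Qed.

Lemma epoch_policy_approximate j t : j \in alive I t ->
  ideal_share I j t / 8 <= epoch_policy I j t.
Proof.
move=> jt; have e0 := entry_base_gt0 jt; have t0 := total_weight_gt0 jt.
have -> : epoch_policy I j t =
    weight I j / 8 * (decay (age I j t) / entry_base I j t).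
  by rewrite /epoch_policy; field; rewrite gt_eqF.
rewrite /ideal_share -/(total_weight I t) mulrAC ler_wpM2l //.
  by rewrite divr_ge0 // ltW // weight_gt0.
rewrite ler_pdivlMr // (le_trans _ (decay_ge _)) // -[leRHS]mul1r.
rewrite ler_pdivlMr ?exprn_gt0 // -mulrA ler_pdivrMl // mulr1.
exact: le_trans (entry_base_age jt) (epoch_base_le t).
Qed.

(** Grouping the jobs by age bounds the sum by that of [decay d / 8 * 2]. *)
Lemma epoch_policy_feasible t : \sum_(j in alive I t) epoch_policy I j t <= 1.
Proof.
have ageP j : j \in alive I t -> (age I j t < n)%N.
  move=> /age_lt_card ltA; apply: leq_trans ltA _.
  by rewrite -[leqRHS]card_ord max_card.
have -> : \sum_(j in alive I t) epoch_policy I j t =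
    \sum_(d < n) decay d / 8 *
      \sum_(j in alive I t | age I j t == d) weight I j / entry_base I j t.
  under [RHS]eq_bigr do rewrite mulr_sumr.
  rewrite [RHS](exchange_big_dep (mem (alive I t))) /=; last by move=> d j _ /andP[].
  apply: eq_bigr => j jt; rewrite (big_pred1 (Ordinal (ageP j jt))) => [|d] /=.
    by rewrite /epoch_policy; field; rewrite (gt_eqF (entry_base_gt0 jt)).
  by rewrite jt -val_eqE eq_sym.
apply: (@le_trans _ _ (\sum_(d < n) decay d / 8 * 2)).
  apply: ler_sum => d _; rewrite ler_wpM2l ?sum_same_age //.
  by rewrite divr_ge0 // invr_ge0 exprn_ge0.
by rewrite -!mulr_suml; have := @sum_decay_le4 R n; lra.
Qed.

Lemma age_notin j t : j \notin alive I t -> age I j t = 0%N.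
Proof. by case: t => //= t /(contra (@aliveS j t))/negPf ->. Qed.

(** The entry base is frozen, so the share changes only when the level of the age rises; the level
    thus serves as a potential that pays for disruptions. *)
Lemma disrupted_level j t : j \in alive I t ->
  (level (age I j t) + (epoch_policy I j t.+1 != epoch_policy I j t)
     <= level (age I j t.+1))%N.
Proof.
move=> jt; rewrite /epoch_policy /= jt.
case: new_epoch; last by rewrite addn0 eqxx addn0.
rewrite addn1 /decay levelS; case: ifP => _; last by rewrite eqxx addn0.
by rewrite -[leqRHS]addn1 leq_add2l leq_b1.
Qed.

Lemma epoch_policy_disruptions j T :
  (disruptions epoch_policy I j T <= level (age I j T))%N.
Proof.
elim: T => [|T IHT].
  by rewrite /disruptions big_ord1 /disrupted eqxx andbF.
rewrite /disruptions big_ord_recr -/(disruptions _ _ _ _) [nat_of_ord ord_max]/=.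
rewrite /disrupted inE -pred_Sn; have [jT|njT] := boolP (j \in alive I T).
  rewrite aliveS //=; apply: leq_trans (disrupted_level jT).
  by rewrite leq_add2r.
apply: leq_trans (_ : disruptions epoch_policy I j T + 0 <= _)%N => //.
by rewrite addn0; move: IHT; rewrite (age_notin njT) leqn0 => /eqP ->.
Qed.

End Instance.

Lemma epoch_policy_online : online epoch_policy.
Proof.
move=> I1 I2 _ _ t same.
have wE s : (s <= t)%N -> total_weight I1 s = total_weight I2 s.
  by move=> /same[eqA eqw]; rewrite /total_weight -eqA; apply: eq_bigr.
have baseE s : (s <= t)%N -> epoch_base I1 s = epoch_base I2 s.
  by elim: s => [|s IHs] st /=; rewrite wE // IHs // ltnW.
have entryE s j : (s <= t)%N -> entry_base I1 j s = entry_base I2 j s.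
  elim: s => [|s IHs] st; first exact: baseE.
  rewrite [LHS]/= [RHS]/= IHs ?(ltnW st) // (same s (ltnW st)).1.
  by have /= -> := baseE _ st.
have ageE s j : (s <= t)%N -> age I1 j s = age I2 j s.
  elim: s => //= s IHs st; rewrite IHs ?(ltnW st) // (same s (ltnW st)).1.
  by rewrite /new_epoch wE // baseE // ltnW.
move=> j jt; rewrite /epoch_policy entryE // ageE //.
by rewrite (same t (leqnn t)).2.
Qed.

End UpperBound.

(** * Disjoint age periods, each forcing a change or a large consumption *)

Section Scales.
Variable q : nat.

Fixpoint scale (i : nat) : nat :=
  if i is i'.+1 then (scale i' + 2 ^ (scale i' + q).+2)%N else 0.

Lemma scale_le_tower i : (2 * scale i <= tower (i + (q + 5)))%N.
Proof.
(* The added [q + 5] strengthens the induction: in the exponent it absorbs the constant factors of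
   the recursion. *)
suff: (2 * scale i + (q + 5) <= tower (i + (q + 5)))%N by lia.
elim: i => [|i IHi]; first by rewrite !add0n ltnW // ltn_tower.
have step : (2 ^ (2 * scale i + (q + 5)) <= 2 ^ tower (i + (q + 5)))%N.
  by rewrite leq_exp2l.
apply: leq_trans step; rewrite /= mulnDr.
set s := scale i; have sE : (s < 2 ^ s)%N by rewrite ltn_expl.
have qE : (q < 2 ^ q)%N by rewrite ltn_expl.
rewrite -[(s + q).+2]addn2 mul2n -addnn !expnD.
by move: (2 ^ s)%N (2 ^ q)%N sE qE => u v; nia.
Qed.

(* On the scale [scale i <= d < scale i.+1] either [f] changes, or it is constant
   and at least [2 ^- (scale i + q)], so that it sums to at least 4. *)
Lemma scales_le_changes (R : realType) (f : nat -> R) m :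
  (forall d, (d < scale m)%N -> 2 ^- (d + q) <= f d) ->
  m%:R <= (\sum_(d < scale m) (f d != f d.-1))%:R + (\sum_(d < scale m) f d) / 4.
Proof.
elim: m => [|m IHm] f_ge; first by rewrite !big_ord0 mul0r addr0.
have ltS : (scale m < scale m.+1)%N by rewrite /= -addn1 leq_add2l expn_gt0.
have {}IHm := IHm (fun d dm => f_ge d (ltn_trans dm ltS)).
rewrite -!(big_mkord xpredT (fun d => f d)) -!(big_mkord xpredT (fun d => f d != f d.-1 : nat)).
rewrite (big_cat_nat _ (ltnW ltS)) // [\sum_(0 <= d < _) f d](big_cat_nat _ (ltnW ltS)) //.
rewrite !big_mkord natrD mulrDl.
set u := (X in (_ + X%:R) + _); set v := \sum_(scale m <= d < scale m.+1) f d.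
suff : 1 <= u%:R + v / 4 by rewrite -[m.+1%:R]natr1; move: IHm; lra.
have v_ge0 : 0 <= v.
  rewrite /v big_nat sumr_ge0 // => d /andP[_ dm].
  by rewrite (le_trans _ (f_ge d dm)) // invr_ge0 exprn_ge0.
have [u0|u_gt0] := posnP u; last first.
  by apply: (@le_trans _ _ u%:R); [rewrite ler1n|rewrite lerDl divr_ge0].
have const d : (scale m + d < scale m.+1)%N -> f (scale m + d)%N = f (scale m).
  elim: d => [|d IHd] dm; first by rewrite addn0.
  rewrite -IHd; last by lia.
  apply/eqP; move: u0 => /eqP; rewrite /u sum_nat_seq_eq0 => /allP /(_ (scale m + d.+1)%N).
  rewrite mem_index_iota dm leq_addr addnS => /(_ isT) /=.
  by rewrite eqb0 negbK.
suff : 4 <= v by rewrite u0; lra.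
have -> : v = f (scale m) *+ (scale m.+1 - scale m).
  rewrite -sumr_const_nat; apply: eq_big_nat => d /andP[md dm].
  by rewrite -(subnKC md) const // subnKC.
(* The period has length [4 * 2 ^ (scale m + q)] and the constant value is at least
   [2 ^- (scale m + q)]. *)
rewrite /= addKn -[f _ *+ _]mulr_natr natrX 2!exprSr -!mulrA mulrA.
have := f_ge _ ltS; rewrite -[_ <= _](ler_pM2r (exprn_gt0 (scale m + q) (ltr0n R 2))).
by rewrite mulVf ?expf_neq0 ?pnatr_eq0 //; lra.
Qed.

End Scales.

(** * Disruptions forced on the geometric instance *)

Section LowerBound.
Context {R : realType} {n : nat}.

Definition geometric_instance : instance R n :=
  @Instance R n (fun t => [set j : 'I_n | (j <= t)%N]) (fun j => 2 ^+ j)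
    (fun j => exprn_gt0 j (ltr0Sn R 1)).

Local Notation I := geometric_instance.

Lemma geometric_arrival : arrival_instance I.
Proof.
split=> [t|j]; last by exists j; rewrite inE.
by apply/subsetP => j; rewrite !inE; apply: leqW.
Qed.

Lemma sum_pow2_le m N : \sum_(i < N | (i <= m)%N) 2 ^+ i <= 2 ^+ minn N m.+1 :> R.
Proof.
elim: N => [|N IHN]; first by rewrite big_ord0 min0n.
rewrite big_mkcond big_ord_recr -big_mkcond; apply: le_trans (lerD IHN (lexx _)) _ => /=.
have [Nm|mN] := leqP N m; last by rewrite addr0 !(minn_idPr _) // ltnW.
by rewrite !(minn_idPl _) ?ltnS ?(ltnW Nm) ?leqW // exprS; lra.
Qed.

(** The weights alive at time [j + d] sum to less than [2 ^+ (j + d).+1]. *)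
Lemma geometric_share j d : 2 ^- d.+1 <= ideal_share I j (j + d).
Proof.
have alive_j : j \in alive I (j + d) by rewrite inE leq_addr.
rewrite /ideal_share ler_pdivlMr ?(total_weight_gt0 alive_j) //.
rewrite mulrC ler_pdivrMr ?exprn_gt0 // -exprD addnS.
rewrite (eq_bigl (fun k : 'I_n => k <= j + d)%N) => [|k]; last by rewrite inE.
apply: le_trans (sum_pow2_le _ _) _.
by rewrite ler_weXn2l ?ler1n // geq_minr.
Qed.

Lemma big_window (T : Type) (idx : T) (op : T -> T -> T) (G : nat -> T) j D :
  \big[op/idx]_(j <= t < j + D) G t = \big[op/idx]_(d < D) G (j + d)%N.
Proof.
rewrite -{1}[j]add0n big_addn addKn big_mkord.
by apply: eq_bigr => d _; rewrite addnC.
Qed.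

Variables (A : policy R n) (c : R) (q : nat).
Hypotheses (A_ge0 : nonneg A) (A_feasible : feasible A).
Hypotheses (A_approx : approximate c A) (c_gt0 : 0 < c) (c_le : c <= 2 ^+ q).

Lemma geometric_alloc_ge0 (j : 'I_n) t : (j <= t)%N -> 0 <= A I j t.
Proof. by move=> jt; apply: A_ge0 geometric_arrival _ _ _; rewrite inE. Qed.

Lemma geometric_alloc_ge (j : 'I_n) d : 2 ^- (d + q.+1) <= A I j (j + d)%N.
Proof.
apply: le_trans (A_approx geometric_arrival _); last by rewrite inE leq_addr.
rewrite ler_pdivlMr // (le_trans _ (geometric_share j d)) //.
rewrite addnS -addSn exprD invfM -mulrA ler_piMr ?invr_ge0 ?exprn_ge0 //.
by rewrite ler_pdivrMl ?exprn_gt0 // mulr1.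
Qed.

Lemma geometric_disruptions (j : 'I_n) m : (j + scale q.+1 m <= n)%N ->
  m%:R <= (disruptions A I j n)%:R + (\sum_(j <= t < n) A I j t) / 4.
Proof.
move=> jm; apply: le_trans (scales_le_changes (fun d _ => geometric_alloc_ge j d)) _.
apply: lerD; last first.
  rewrite ler_wpM2r ?invr_ge0 ?ler0n //=.
  have := big_window 0 +%R (A I j) j (scale q.+1 m) => <-.
  rewrite [X in _ <= X](big_cat_nat (leq_addr _ _) jm) //= lerDl.
  rewrite big_nat sumr_ge0 // => t /andP[/(leq_trans (leq_addr _ _))].
  by move=> jt _; exact: geometric_alloc_ge0.
rewrite ler_nat /disruptions -(big_mkord xpredT (fun t => disrupted A I j t : nat)).
rewrite (big_cat_nat (leq0n j)) /=; last by rewrite ltnW // ltnS ltnW.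
apply: leq_trans (leq_addl _ _).
rewrite (big_cat_nat (leq_addr (scale q.+1 m) j)) /=; last exact: leqW.
apply: leq_trans (leq_addr _ _); rewrite big_window; apply: leq_sum => -[[|d] dm] _ /=.
  (* Age 0 counts no change, since [0.-1 = 0]; this matches the fact that an arrival is no
     disruption. *)
  by rewrite eqxx.
by rewrite /disrupted !inE !addnS /= leq_addr leqW ?leq_addr.
Qed.

Lemma geometric_total_disruptions m : (2 * scale q.+1 m <= n)%N ->
  m%:R * n%:R / 2 <= (total_disruptions A I n)%:R + n%:R / 4 :> R.
Proof.
set D := scale _ _ => Dn.
have alloc_le : \sum_(j < n) \sum_(j <= t < n) A I j t <= n%:R :> R.
  under eq_bigr do rewrite big_geq_mkord.
  (* Summed time by time instead, feasibility gives at most 1 for each of the [n] times. *)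
  rewrite (exchange_big_dep xpredT) //=.
  apply: le_trans (_ : \sum_(t < n) 1 <= _); last by rewrite sumr_const card_ord.
  apply: ler_sum => t _; apply: le_trans (A_feasible geometric_arrival t).
  by rewrite le_eqVlt; apply/orP; left; apply/eqP/eq_bigl => j; rewrite inE.
have alloc_ge0 (j : 'I_n) : 0 <= \sum_(j <= t < n) A I j t.
  by rewrite big_nat sumr_ge0 // => t /andP[jt _]; exact: geometric_alloc_ge0.
suff : m%:R * (n - D)%:R <= (total_disruptions A I n)%:R + n%:R / 4 :> R.
  apply: le_trans; rewrite -mulrA ler_wpM2l // ler_pdivrMr // -natrM ler_nat.
  lia.
apply: (@le_trans _ _ (\sum_(j < n)
    ((disruptions A I j n)%:R + (\sum_(j <= t < n) A I j t) / 4))); last first.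
  by rewrite big_split /= -mulr_suml -natr_sum lerD2l ler_wpM2r ?invr_ge0 ?ler0n.
(* Only the jobs [j < n - D], at least half of all, are sure to complete the [m] periods by time
   [n]; the others contribute a nonnegative amount. *)
rewrite (bigID (fun j : 'I_n => j < n - D)%N) /=; apply: ler_wpDr.
  by rewrite sumr_ge0 // => j _; rewrite addr_ge0 // divr_ge0.
apply: le_trans (_ : \sum_(j < n | (j < n - D)%N) m%:R <= _); last first.
  apply: ler_sum => j jD; apply: geometric_disruptions.
  by rewrite -/D; lia.
by rewrite (big_ord_narrow (leq_subr D n)) sumr_const card_ord mulr_natr.
Qed.

End LowerBound.

(** * Assembly of both bounds and choice of the constants *)

Lemma epoch_policy_works (R : realType) (n : nat) :
  [/\ online_policy (@epoch_policy R n), feasible (@epoch_policy R n),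
      approximate 8 (@epoch_policy R n) &
      forall I : instance R n, arrival_instance I ->
      forall (j : 'I_n) (T : nat),
        (disruptions epoch_policy I j T <= logstar R n)%N].
Proof.
split.
- split; last exact: epoch_policy_online.
  move=> I [arrI _] t j jt; rewrite /epoch_policy mulr_ge0 //.
    rewrite divr_ge0 ?mulr_ge0 // ltW ?weight_gt0 //; exact: entry_base_gt0 jt.
  by rewrite invr_ge0 exprn_ge0.
- by move=> I [arrI _] t; exact: epoch_policy_feasible.
- by move=> I [arrI _] t j; exact: epoch_policy_approximate.
move=> I [arrI _] j T; apply: leq_trans (epoch_policy_disruptions arrI j T) _.
have [jT|njT] := boolP (j \in alive I T).
  apply: level_le_logstar; apply: leq_trans (age_lt_card arrI jT) _.
  by rewrite -[leqRHS]card_ord max_card.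
by rewrite age_notin.
Qed.

Theorem theorem1p2 (R : realType) :
  (exists c C : R, [/\ 1 <= c, 0 < C &
     forall n : nat, (1 <= n)%N ->
     exists A : policy R n,
       [/\ online_policy A, feasible A, approximate c A &
         forall I : instance R n, arrival_instance I ->
         forall (j : 'I_n) (T : nat),
           (disruptions A I j T)%:R <= C * (logstar R n)%:R]])
  /\
  (forall c : R, 1 <= c ->
     exists (kappa : R) (n0 : nat), 0 < kappa /\
       forall n : nat, (n0 <= n)%N ->
       forall A : policy R n,
         online_policy A -> feasible A -> approximate c A ->
         exists I : instance R n, arrival_instance I /\
           exists T : nat,
             kappa * n%:R * (logstar R n)%:R <= (total_disruptions A I T)%:R).
Proof.
split.
  exists 8, 1; split=> [|//|n _]; first by rewrite ler1n.
  exists epoch_policy; have [? ? ? few] := epoch_policy_works R n.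
  by split=> // I arrI j T; rewrite mul1r ler_nat few.
move=> c c_ge1; have c_gt0 : 0 < c by exact: lt_le_trans c_ge1.
have [q c_le] : exists q, c <= 2 ^+ q.
  exists (Num.truncn c).+1; apply: le_trans (ltW (truncnS_gt c)) _.
  by rewrite -natrX ler_nat ltnW // ltn_expl.
(* This [n0] forces [L > 2 * (q + 7)], so that [L <= 2 * m] and [m >= 1] below; then [m * n / 2 - n
   / 4 >= m * n / 4 >= L * n / 8]. *)
exists (1 / 8), (tower (2 * (q + 7))).+1; split=> [|n n_big A [A_ge0 _] A_feas A_approx].
  by rewrite divr_gt0.
exists geometric_instance; split; first exact: geometric_arrival.
exists n; set L := logstar R n.
have L_big : (2 * (q + 7) < L)%N by rewrite ltnNge logstar_leq -ltnNge.
have n_gt : (tower L.-1 < n)%N by rewrite ltnNge -(@logstar_leq R) -ltnNge; lia.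
(* The shift [q + 6] is the one of [scale_le_tower] at [q.+1], so that [m] periods fit below
   [tower L.-1 < n]. *)
pose m := (L.-1 - (q + 6))%N.
have mn : (2 * scale q.+1 m <= n)%N.
  apply: leq_trans (scale_le_tower _ _) (ltnW _).
  by have -> : (m + (q.+1 + 5) = L.-1)%N by rewrite /m; lia.
have := geometric_total_disruptions A_ge0 A_feas A_approx c_gt0 c_le mn.
have L_le : L%:R <= 2 * m%:R :> R by rewrite -natrM ler_nat /m; lia.
have m_ge1 : 1 <= m%:R :> R by rewrite ler1n /m; lia.
have := ler0n R n; move: (total_disruptions _ _ _)%:R L_le m_ge1 => u.
by move: m%:R n%:R L%:R => x y z; nra.
Qed.
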